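(* Let $G$ be an incomparability graph. Then there is an ordered clique cover $C=\{C_0,C_1,\dots,C_k\}$ of $G$ such that $s(G)-1\ge W(C)\ge\lceil s(G)/2\rceil-1$. Moreover, if $\hat G$, a transitive orientation of the complement $\bar G$, is given in adjacency list form, then such a $C$ and the value $W(C)$ can be computed in $O(|V(G)|+|E(G)|)$ time.
   Context: An incomparability graph is the complement of a comparability graph, i.e. $\bar G$ is the underlying undirected graph of a strict partial order; $\hat G$ denotes the corresponding transitively oriented directed acyclic graph on $V(G)$. A clique cover of $G$ is a set of pairwise vertex-disjoint cliques covering each vertex exactly once, listed in the given order; its width is $W(C)=\max\{|j-i| : xy\in E(G),\ x\in C_i,\ y\in C_j\}$. $s(G)$ is the number of leaves of a largest induced star (induced $K_{1,s}$) in $G$; $s(G)=1$ when $|V(G)|\le2$.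
   Formalization: The time bound proved is O(|V(G)|+|E(Ĝ)|), linear in the given adjacency lists, since O(|V(G)|+|E(G)|) fails already for edgeless G (Ĝ a total order); and s(G) is taken to be 1 for every edgeless graph, where s(G)=0 would make s(G)-1≥W(C) false. *)

(* Defs.v *)
From mathcomp Require Import all_boot all_order all_algebra.

Set Implicit Arguments.
Unset Strict Implicit.
Unset Printing Implicit Defensive.

(** * Graphs *)

Section Graphs.
Variable T : finType.
Implicit Types (G H lt : rel T) (A L : {set T}) (C : seq {set T}).

Definition simple_graph G : Prop := symmetric G /\ irreflexive G.

Definition complement G : rel T := [rel x y | (x != y) && ~~ G x y].

Definition underlying lt : rel T := [rel x y | lt x y || lt y x].

Definition strict_order lt : Prop := irreflexive lt /\ transitive lt.

(* [lt x y] is the arc from [x] to [y]; a strict order is asymmetric, so each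
   edge of [H] receives exactly one direction. *)
Definition transitive_orientation lt H : Prop :=
  strict_order lt /\ H =2 underlying lt.

Definition incomparability_graph G : Prop :=
  simple_graph G /\ exists lt : rel T, transitive_orientation lt (complement G).

Definition clique G A : bool :=
  [forall x in A, forall y in A, (x != y) ==> G x y].

(* [partition] makes the cliques nonempty and pairwise disjoint. *)
Definition ordered_clique_cover G C : bool :=
  [&& uniq C, partition [set A in C] [set: T] & all (clique G) C].

(* The maximum of the empty set is 0, so an edgeless graph has width 0. *)
Definition width G C : nat :=
  \max_(i < size C) \max_(j < size C |
      [exists x in nth set0 C i, exists y in nth set0 C j, G x y])
    `|j - i|%N.

(* [x] and [L] are the centre and the leaves of an induced K_{1,#|L|}. *)
Definition induced_star G (x : T) L : bool :=
  [forall y in L, G x y] && [forall y in L, forall z in L, ~~ G y z].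

(* The [maxn 1] is the convention s(G) = 1 for graphs on at most two vertices,
   extended to the only other graphs without a star with a leaf, the edgeless
   ones. *)
Definition star_number G : nat :=
  maxn 1 (\max_(x : T) \max_(L : {set T} | induced_star G x L) #|L|).

Definition width_between_star_bounds G C : Prop :=
  width G C <= star_number G - 1 /\ uphalf (star_number G) - 1 <= width G C.

End Graphs.

Lemma star_number_small (T : finType) (G : rel T) :
  irreflexive G -> #|T| <= 2 -> star_number G = 1.
Proof.
move=> irrG leT2; apply/maxn_idPl.
apply/bigmax_leqP => x _; apply/bigmax_leqP => L /andP[/forall_inP adjx _].
have xL : x \notin L by apply/negP => /adjx; rewrite irrG.
by have := leq_trans (max_card [in x |: L]) leT2; rewrite cardsU1 xL.
Qed.

(** * Random access machines with unit cost

   Numbers are held in registers and in arrays, which a program addresses by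
   constants; arrays are indexed by the content of a register.  Two registers
   cannot be added or multiplied: every number appearing in a run of [t] steps
   is at most [t] plus the largest number that occurs in the program or is found
   in the initial memory, so counting each operation as one step does not hide any work on long
   integers. *)

Record state := State {
  reg : nat -> nat;
  arr : nat -> nat -> nat
}.

Definition update (f : nat -> nat) (a v : nat) : nat -> nat :=
  fun b => if b == a then v else f b.

Definition set_reg (s : state) (r v : nat) : state :=
  State (update (reg s) r v) (arr s).

Definition set_arr (s : state) (a i v : nat) : state :=
  State (reg s) (fun b => if b == a then update (arr s a) i v else arr s b).

Inductive cmd :=
| Skip
| Const (r k : nat)
| Move (r p : nat)
| Succ (r p : nat)
| Sub (r p q : nat)
| Read (r a p : nat)
| Write (a p q : nat)
| Seq (c1 c2 : cmd)
| IfLt (p q : nat) (c1 c2 : cmd)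
| WhileLt (p q : nat) (c : cmd).

(* [exec c s t s']: from [s], the program [c] halts in [s'] after [t] steps. *)
Inductive exec : cmd -> state -> nat -> state -> Prop :=
| ExecSkip s : exec Skip s 1 s
| ExecConst r k s : exec (Const r k) s 1 (set_reg s r k)
| ExecMove r p s : exec (Move r p) s 1 (set_reg s r (reg s p))
| ExecSucc r p s : exec (Succ r p) s 1 (set_reg s r (reg s p).+1)
| ExecSub r p q s : exec (Sub r p q) s 1 (set_reg s r (reg s p - reg s q))
| ExecRead r a p s : exec (Read r a p) s 1 (set_reg s r (arr s a (reg s p)))
| ExecWrite a p q s :
    exec (Write a p q) s 1 (set_arr s a (reg s p) (reg s q))
| ExecSeq c1 c2 s1 t1 s2 t2 s3 :
    exec c1 s1 t1 s2 -> exec c2 s2 t2 s3 -> exec (Seq c1 c2) s1 (t1 + t2) s3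
| ExecIfTrue p q c1 c2 s t s' :
    reg s p < reg s q -> exec c1 s t s' -> exec (IfLt p q c1 c2) s t.+1 s'
| ExecIfFalse p q c1 c2 s t s' :
    reg s q <= reg s p -> exec c2 s t s' -> exec (IfLt p q c1 c2) s t.+1 s'
| ExecWhileDone p q c s :
    reg s q <= reg s p -> exec (WhileLt p q c) s 1 s
| ExecWhileStep p q c s1 t1 s2 t2 s3 :
    reg s1 p < reg s1 q -> exec c s1 t1 s2 ->
    exec (WhileLt p q c) s2 t2 s3 -> exec (WhileLt p q c) s1 (t1 + t2).+1 s3.

(** * Linked lists in memory *)

(* Cell [p] contains [data p] and the address [next p] of the next cell;
   0 is the null address. *)
Fixpoint linked_list (data next : nat -> nat) (p : nat) (l : seq nat) : Prop :=
  if l is x :: l' then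
    [/\ 0 < p, data p = x & linked_list data next (next p) l']
  else p = 0.

(* For each [i < k], array [a] holds at index [i] the address of a linked list,
   with cells in arrays [a.+1] and [a.+2], that lists the elements of [F i] once
   each, in any order. *)
Definition holds_sets (s : state) (a k n : nat) (F : 'I_k -> {set 'I_n}) :
    Prop :=
  forall i : 'I_k, exists2 l : seq 'I_n, uniq l /\ l =i F i &
    linked_list (arr s a.+1) (arr s a.+2) (arr s a i) (map val l).

(* Nothing is assumed about the rest of the memory. *)
Definition input_adjacency_lists (n : nat) (D : rel 'I_n) (s : state) : Prop :=
  reg s 0 = n /\ holds_sets s 0 (fun v => [set w | D v w]).

Definition outputs (n : nat) (C : seq {set 'I_n}) (w : nat) (s : state) : Prop :=
  [/\ reg s 0 = size C, reg s 1 = w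
    & holds_sets s 3 (fun i : 'I_(size C) => nth set0 C i)].

(* The number of cells in the adjacency lists of [D].  When [D] orients the
   complement of [G], a time bound linear in the size of the input is linear in
   this number plus the number of vertices.  A bound linear in the numbers of
   vertices and edges of [G] itself cannot hold: for edgeless [G], [D] is a total
   order, and to tell it from one with two consecutive vertices made
   incomparable, which then have to share a clique, a program must read
   quadratically many cells in the worst case. *)
Definition number_of_arcs (T : finType) (D : rel T) : nat :=
  #|[set e : T * T | D e.1 e.2]|.

(* Main.v *)
From mathcomp Require Import zify.
Require Import Defs.
From mathcomp Require Import all_boot all_order all_algebra.

Set Implicit Arguments.
Unset Strict Implicit.
Unset Printing Implicit Defensive.

(* The cliques are the layers of the strict order [D]: the layer of [x] is the
   length of a longest chain going up from [x].  If [x] and [y] are incomparable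
   and [layer x <= layer y], a chain from [y] through the layers
   [layer y, ..., layer x] consists of neighbours of [x] in [G], which are the
   [layer y - layer x + 1] leaves of a star.  Conversely the leaves of a star form
   a chain, so they lie in distinct layers, all at distance at most the width [W]
   from the layer of the centre, and there are at most [2 W + 1] of them.

   All vertices above [x] lie in lower layers, so the neighbour of [x] in the
   lowest layer lies in the first layer not contained in the out-neighbourhood of
   [x]; that layer is found in time proportional to the out-degree of [x]. *)

(** * The layers of a strict order *)

Section Layers.
Variables (T : finType) (D : rel T).
Implicit Types x y z : T.

Definition outdeg x : nat := #|[set y | D x y]|.

(** The argument [k] is fuel for the recursion; [#|T|] units suffice because out-degrees strictly
    decrease along arcs. *)
Fixpoint bounded_layer (k : nat) x : nat :=
  if k is k'.+1 then \max_(y | D x y) (bounded_layer k' y).+1 else 0.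

Definition layer : T -> nat := bounded_layer #|T|.

Definition height : nat := \max_x (layer x).+1.

Definition layers : seq {set T} := mkseq (fun i => [set x | layer x == i]) height.

Lemma nth_layers i : i < height -> nth set0 layers i = [set x | layer x == i].
Proof. exact: nth_mkseq. Qed.

(** For a strict order only vertices incomparable to [x] can contribute: for [x] itself and for
    vertices with an arc to [x] the truncated difference is 0. *)
Definition reach x : nat := \max_(y | ~~ D x y) (layer x - layer y).

Lemma layer_lt_height x : layer x < height.
Proof. exact: (leq_bigmax (F := fun x => (layer x).+1)). Qed.

Lemma sum_outdeg : \sum_x outdeg x = number_of_arcs D.
Proof.
rewrite /number_of_arcs -sum1dep_card -(pair_big_dep xpredT D (fun _ _ => 1)) /=.
by apply: eq_bigr => x _; rewrite sum1dep_card.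
Qed.

Hypothesis ordD : strict_order D.

Let irrD : irreflexive D := ordD.1.
Let trD : transitive D := ordD.2.

(** By transitivity the out-neighbourhood of [y] lies in that of [x], which also contains [y]. *)
Lemma outdeg_lt x y : D x y -> outdeg y < outdeg x.
Proof.
move=> Dxy; apply/proper_card/properP; split.
  by apply/subsetP => z; rewrite !inE; apply: trD.
by exists y; rewrite !inE ?irrD.
Qed.

Lemma bounded_layer_stable k x :
  outdeg x <= k -> bounded_layer k.+1 x = bounded_layer k x.
Proof.
elim: k x => [|k IHk] x degx.
  rewrite /= big_pred0 // => y; apply/negP => /outdeg_lt.
  by rewrite ltnNge (leq_trans degx).
rewrite [LHS]/= [RHS]/=; apply: eq_bigr => y /outdeg_lt degy.
by rewrite -IHk // -ltnS (leq_trans degy).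
Qed.

Lemma layerE x : layer x = \max_(y | D x y) (layer y).+1.
Proof. by rewrite /layer -[LHS]bounded_layer_stable // max_card. Qed.

Lemma layer_lt x y : D x y -> layer y < layer x.
Proof.
by move=> Dxy; rewrite [layer x]layerE (bigmax_sup y).
Qed.

Lemma layer_pred x i : layer x = i.+1 -> exists2 y, D x y & layer y = i.
Proof.
move=> lx; case: (pickP (D x)) => [y0 Dxy0|D0]; last first.
  by move: lx; rewrite layerE big_pred0.
have [|y Dxy lxy] := @eq_bigmax_cond _ (D x) (fun y => (layer y).+1).
  by apply/card_gt0P; exists y0.
by exists y => //; apply: succn_inj; rewrite -lxy -lx [RHS]layerE.
Qed.

(** Supplies the leaves of the star in the upper bound on the width. The chain steps from [y] to an
    out-neighbour one layer lower, down to layer [i]; transitivity makes [y] comparable to all later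
    vertices. *)
Lemma layer_chain y i : i <= layer y ->
  exists L : {set T}, [/\ #|L| = (layer y - i).+1,
    forall z, z \in L -> (z = y \/ D y z) /\ i <= layer z &
    {in L &, forall z z', [|| z == z', D z z' | D z' z]}].
Proof.
move: {2}(layer y - i) (erefl (layer y - i)) => m.
elim: m y => [|m IHm] y def_m le_iy.
  exists [set y]; split=> [|z|z z']; rewrite ?cards1 ?def_m ?inE //.
    by move/eqP->; split; first left.
  by move=> /eqP-> /eqP->; rewrite eqxx.
have lt_iy : i < layer y by rewrite -subn_gt0 def_m.
have y_gt0 : 0 < layer y by apply: leq_ltn_trans lt_iy.
have [|y' Dyy' ly'] := @layer_pred y (layer y).-1; first by rewrite prednK.
have [||L [cardL subL chainL]] := IHm y'.
- by rewrite ly' -subn1 subnAC def_m subn1.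
- by rewrite ly' -ltnS prednK.
have yL z : z \in L -> D y z.
  by case/subL => -[-> // | Dy'z] _; apply: trD Dy'z.
exists (y |: L); split=> [|z|z z'].
- rewrite cardsU1 cardL ly' def_m (_ : y \notin L) /=; last first.
    by apply/negP => /yL; rewrite irrD.
  by rewrite add1n -subn1 subnAC def_m subn1.
- rewrite !inE => /predU1P[-> | zL]; first by split; first left.
  by split; [right; apply: yL | case: (subL z zL)].
rewrite !inE => /predU1P[-> | zL] /predU1P[-> | z'L]; rewrite ?eqxx //.
- by rewrite yL ?orbT.
- by rewrite yL ?orbT.
exact: chainL.
Qed.

(** Each arc of a chain costs at least one unit of out-degree. The bound keeps layer numbers below
    the number of vertices and pays for the scan in [find_width]. *)
Lemma layer_le_outdeg x : layer x <= outdeg x.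
Proof.
elim: {x}(outdeg x) {-2}x (leqnn (outdeg x)) => [|d IHd] x degx.
  rewrite layerE; apply/bigmax_leqP => y /outdeg_lt degy.
  by have := leq_trans degy degx.
rewrite layerE; apply/bigmax_leqP => y Dxy; have degy := outdeg_lt Dxy.
by rewrite (leq_ltn_trans (IHd y _)) // -ltnS (leq_trans degy).
Qed.

(** Describes where the scan stops: [i] is the first layer with a vertex that is not an
    out-neighbour of [x], so such a vertex maximises the difference. *)
Lemma reachE x i :
  (exists2 y, ~~ D x y & layer y = i) -> (forall y, layer y < i -> D x y) ->
  reach x = layer x - i.
Proof.
move=> [y nDxy ly] below; apply/eqP; rewrite eqn_leq; apply/andP; split.
  apply/bigmax_leqP => z nDxz; apply: leq_sub2l.
  by rewrite leqNgt; apply: contra nDxz; apply: below.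
by rewrite -ly; apply: leq_bigmax_cond.
Qed.

Lemma outdeg_lt_card x : outdeg x < #|T|.
Proof.
rewrite -cardsT; apply/proper_card/properP; split; first exact: subsetT.
by exists x; rewrite !inE ?irrD.
Qed.

(** * The layers as a clique cover, and the bounds on its width *)

Section Cover.
Variable G : rel T.
Hypotheses (simpleG : simple_graph G)
  (orientD : transitive_orientation D (complement G)).

Lemma adjacentE x y : G x y = [&& x != y, ~~ D x y & ~~ D y x].
Proof.
rewrite -negb_or -[_ || _]/(underlying D x y) -orientD.2 /complement /=.
by case: eqVneq => [->|_] /=; rewrite ?simpleG.2 ?negbK.
Qed.

Lemma size_layers : size layers = height.
Proof. exact: size_mkseq. Qed.

(** By [layer_pred] a suitable chain from [x] drops by exactly one layer per arc and so skips
    none. *)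
Lemma layer_attained x i : i <= layer x -> exists y, layer y = i.
Proof.
move=> le_ix; rewrite -(subKn le_ix); elim: (layer x - i) => [|m [y ly]].
  by exists x; rewrite subn0.
rewrite subnS; case def_l: (layer x - m) => [|l] /=; first by exists y; rewrite ly.
by case: (@layer_pred y l) => [|z _]; [rewrite ly | exists z].
Qed.

Lemma layers_nonempty i : i < height -> exists x, layer x = i.
Proof.
move=> lt_iK; case: (pickP T) => [x0 _ | T0]; last first.
  by move: lt_iK; rewrite /height big_pred0.
have [|x def_K] := @eq_bigmax T (fun x => (layer x).+1); first by apply/card_gt0P; exists x0.
by apply: (@layer_attained x); rewrite -ltnS -def_K.
Qed.

(** Arcs strictly lower the layer, so distinct vertices of one layer are incomparable, that is,
    adjacent in [G]. *)
Lemma layers_cover : ordered_clique_cover G layers.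
Proof.
apply/and3P; split.
- apply/mkseq_uniqP => i j /layers_nonempty[x lx] _ /setP/(_ x).
  by rewrite !inE lx eqxx => /esym/eqP.
- have mem_layers A : A \in layers -> exists2 i, i < height & A = [set x | layer x == i].
    by case/mapP => i; rewrite mem_iota => /andP[_ ltiK] ->; exists i.
  apply/and3P; split.
  + apply/eqP/setP => x; rewrite inE; apply/bigcupP.
    exists [set y | layer y == layer x]; last by rewrite inE.
    by rewrite inE; apply/mapP; exists (layer x); rewrite // mem_iota layer_lt_height.
  + apply/trivIsetP => A B; rewrite !inE.
    move=> /mem_layers[i _ ->] /mem_layers[j _ ->] neqAB.
    rewrite -setI_eq0; apply/eqP/setP => x; rewrite !inE.
    apply/negP => /andP[/eqP lxi /eqP lxj].
    by rewrite -lxi -lxj eqxx in neqAB.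
  + rewrite inE; apply/negP => /mem_layers[i /layers_nonempty[x lx] /setP/(_ x)].
    by rewrite !inE lx eqxx.
apply/allP => A /mapP[i _ ->]; apply/forall_inP => x; rewrite inE => /eqP lx.
apply/forall_inP => y; rewrite inE => /eqP ly; apply/implyP => neq_xy.
by rewrite adjacentE neq_xy /=; apply/andP; split; apply/negP => /layer_lt; rewrite lx ly ltnn.
Qed.

(** The truncated difference suffices: by symmetry of [G] each edge is met in both directions, one
    of which gives the distance. *)
Lemma width_layers_leq m :
  reflect (forall x y, G x y -> layer y - layer x <= m) (width G layers <= m).
Proof.
apply: (iffP idP) => [le_m x y Gxy | le_m].
  apply: leq_trans le_m.
  have ltK z : layer z < size layers by rewrite size_layers layer_lt_height.
  apply: leq_trans (leq_bigmax (Ordinal (ltK x))).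
  rewrite (bigmax_sup (Ordinal (ltK y))) //=.
    apply/exists_inP; exists x; first by rewrite nth_layers ?layer_lt_height ?inE.
    by apply/exists_inP; exists y; rewrite // nth_layers ?layer_lt_height ?inE.
  case: (leqP (layer x) (layer y)) => [le_xy | /ltnW].
    by rewrite distnEl.
  by rewrite -subn_eq0 => /eqP->.
apply/bigmax_leqP => i _; apply/bigmax_leqP => j /exists_inP[x + /exists_inP[y]].
have ltK (k : 'I_(size layers)) : k < height by rewrite -size_layers.
rewrite !nth_layers // !inE => /eqP<- /eqP<- Gxy.
case: (leqP (layer x) (layer y)) => [le_xy | /ltnW le_yx].
  by rewrite distnEl ?le_m.
by rewrite distnEr ?le_m // simpleG.1.
Qed.

Lemma width_layers_star : width_between_star_bounds G layers.
Proof.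
split.
  apply/width_layers_leq => x y Gxy.
  case: (ltnP (layer y) (layer x)) => [/ltnW | le_xy].
    by rewrite -subn_eq0 => /eqP->.
  have [L [cardL subL chainL]] := layer_chain le_xy.
  rewrite leq_subRL ?leq_maxl // add1n -cardL; apply: leq_trans (leq_maxr _ _).
  rewrite (bigmax_sup x) // (bigmax_sup L) //; apply/andP; split.
    (* An arc from [z] to [x] would yield one from [y] to [x]; an arc from [x] to [z] would put [z]
       below the layer of [x]. *)
    apply/forall_inP => z /subL[yz le_xz]; move: Gxy; rewrite !adjacentE => /and3P[neq_xy Dxy Dyx].
    have Dzx : ~~ D z x.
      by case: yz => [->|Dyz] //; apply: contra Dyx; apply: trD.
    rewrite Dzx andbT; apply/andP; split.
      by apply/eqP => eq_xz; case: yz Dyx neq_xy => [<-|]; rewrite ?eq_xz ?eqxx // => ->.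
    by apply/negP => /layer_lt; rewrite ltnNge le_xz.
  apply/forall_inP => z zL; apply/forall_inP => z' z'L.
  by rewrite adjacentE -!negb_or chainL.
set W := width G layers.
have distW x y : G x y -> layer y - layer x <= W by apply/width_layers_leq.
(* With at most [2 W + 1] leaves, half the star number rounded up is at most [W + 1]. *)
suff le_star x L : induced_star G x L -> #|L| <= W.*2.+1.
  rewrite leq_subLR add1n leq_uphalf_double doubleS geq_max /=; apply/ltnW.
  rewrite ltnS; apply/bigmax_leqP => x _; apply/bigmax_leqP => L; exact: le_star.
case/andP=> /forall_inP adjx /forall_inP indepL.
(* The layer of a leaf relative to that of [x], shifted by [W] to be natural. It separates the
   leaves, since distinct leaves are comparable. *)
pose pos z : 'I_(W.*2.+1) := inord (layer z + W - layer x).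
have near_x z : z \in L -> layer x <= layer z + W /\ layer z <= layer x + W.
  move/adjx => Gxz; split; first by rewrite -leq_subLR distW // simpleG.1.
  by rewrite -leq_subLR distW.
have posE z : z \in L -> pos z = layer z + W - layer x :> nat.
  case/near_x => _ le_zx; rewrite inordK // ltnS leq_subLR -addnn addnA.
  by rewrite leq_add2r.
rewrite -(@card_in_imset _ _ pos) => [|z z' zL z'L /(congr1 val)/=].
  by rewrite -[leqRHS]card_ord max_card.
have [[le_z _] [le_z' _]] := (near_x z zL, near_x z' z'L).
rewrite !posE // => /(congr1 (addn^~ (layer x))); rewrite !subnK // => /addIn eq_lzz'.
apply/eqP/negPn/negP => neq_zz'.
have /forall_inP/(_ z' z'L) := indepL z zL.
rewrite adjacentE neq_zz' /=; apply/negP/negPn/andP.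
by split; apply/negP => /layer_lt; rewrite eq_lzz' ltnn.
Qed.

(** A vertex in a lower layer than [x] has no arc to [x]; if it is not an out-neighbour of [x]
    either, it is adjacent to [x]. *)
Lemma width_layers_reach : width G layers = \max_x reach x.
Proof.
apply/eqP; rewrite eqn_leq; apply/andP; split.
  apply/width_layers_leq => x y Gxy; apply: leq_trans (leq_bigmax y).
  by apply: leq_bigmax_cond; move: Gxy; rewrite adjacentE => /and3P[].
apply/bigmax_leqP => x _; apply/bigmax_leqP => y nDxy.
have [|lt_yx] := leqP (layer x) (layer y); first by rewrite -subn_eq0 => /eqP->.
have /width_layers_leq := leqnn (width G layers); apply.
rewrite adjacentE nDxy andbT; apply/andP; split.
  by apply: contraTneq lt_yx => ->; rewrite ltnn.
by apply: contraL lt_yx => /layer_lt /ltnW; rewrite leqNgt.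
Qed.

End Cover.
End Layers.

(** * Time-bounded total correctness *)

Local Notation "c1 ;; c2" := (Seq c1 c2) (at level 61, right associativity).

Definition runs (c : cmd) (s : state) (T : nat) (Q : state -> Prop) : Prop :=
  exists t s', [/\ exec c s t s', t <= T & Q s'].

Lemma runs_weaken c s T T' (Q Q' : state -> Prop) :
  runs c s T Q -> T <= T' -> (forall s', Q s' -> Q' s') -> runs c s T' Q'.
Proof.
move=> [t [s' [ex le_tT Qs']]] le_TT' QQ'; exists t, s'.
by split; [| apply: leq_trans le_TT' | apply: QQ'].
Qed.

Lemma runs_leq c s T T' Q : runs c s T Q -> T <= T' -> runs c s T' Q.
Proof. by move=> runT le_TT'; apply: runs_weaken runT le_TT' _. Qed.

Lemma runs_seq c1 c2 s T1 T2 Q :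
  runs c1 s T1 (fun s1 => runs c2 s1 T2 Q) -> runs (c1 ;; c2) s (T1 + T2) Q.
Proof.
move=> [t1 [s1 [ex1 le1 [t2 [s2 [ex2 le2 Qs2]]]]]]; exists (t1 + t2), s2.
by split; [apply: ExecSeq ex2 | apply: leq_add |].
Qed.

Lemma runs_while_done p q c s T (Q : state -> Prop) :
  0 < T -> reg s q <= reg s p -> Q s -> runs (WhileLt p q c) s T Q.
Proof. by move=> T_gt0 le_qp Qs; exists 1, s; split=> //; apply: ExecWhileDone. Qed.

Lemma runs_while_step p q c s T1 T2 Q :
  reg s p < reg s q -> runs c s T1 (fun s1 => runs (WhileLt p q c) s1 T2 Q) ->
  runs (WhileLt p q c) s (T1 + T2).+1 Q.
Proof.
move=> lt_pq [t1 [s1 [ex1 le1 [t2 [s2 [ex2 le2 Qs2]]]]]]; exists (t1 + t2).+1, s2.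
by split; [apply: ExecWhileStep ex1 ex2 | rewrite ltnS leq_add |].
Qed.

(** * Loop-free programs, verified by evaluation *)

Fixpoint loop_free c : bool :=
  match c with
  | c1 ;; c2 | IfLt _ _ c1 c2 => loop_free c1 && loop_free c2
  | WhileLt _ _ _ => false
  | _ => true
  end.

(** On loops, which [loop_free] excludes, the value is a dummy. *)
Fixpoint run c s : state :=
  match c with
  | Skip | WhileLt _ _ _ => s
  | Const r k => set_reg s r k
  | Move r p => set_reg s r (reg s p)
  | Succ r p => set_reg s r (reg s p).+1
  | Defs.Sub r p q => set_reg s r (reg s p - reg s q)
  | Read r a p => set_reg s r (arr s a (reg s p))
  | Write a p q => set_arr s a (reg s p) (reg s q)
  | c1 ;; c2 => run c2 (run c1 s)
  | IfLt p q c1 c2 => if reg s p < reg s q then run c1 s else run c2 s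
  end.

(** Both branches of a conditional are charged, so that the bound does not depend on the state. *)
Fixpoint run_time c : nat :=
  match c with
  | c1 ;; c2 => run_time c1 + run_time c2
  | IfLt _ _ c1 c2 => (run_time c1 + run_time c2).+1
  | _ => 1
  end.

Lemma runs_loop_free c s T (Q : state -> Prop) :
  loop_free c -> run_time c <= T -> Q (run c s) -> runs c s T Q.
Proof.
move=> lfc leT Qs; suff [t ext le_t] : exists2 t, exec c s t (run c s) & t <= run_time c.
  by exists t, (run c s); split=> //; apply: leq_trans leT.
elim: c lfc s {T leT Q Qs} => /= [|r k|r p|r p|r p q|r a p|a p q|
    c1 IH1 c2 IH2|p q c1 IH1 c2 IH2|//].
1-7: by move=> _ s; exists 1 => //; constructor.
  case/andP=> /IH1 run1 /IH2 run2 s.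
  have [[t1 ex1 le1] [t2 ex2 le2]] := (run1 s, run2 (run c1 s)).
  by exists (t1 + t2); [apply: ExecSeq ex2 | apply: leq_add].
case/andP=> /IH1 run1 /IH2 run2 s.
have [[t1 ex1 le1] [t2 ex2 le2]] := (run1 s, run2 s).
case: ltnP => cmp_pq; [exists t1.+1 | exists t2.+1].
- exact: ExecIfTrue.
- by rewrite ltnS (leq_trans le1) ?leq_addr.
- exact: ExecIfFalse.
by rewrite ltnS (leq_trans le2) ?leq_addl.
Qed.

Lemma runs_step c1 c2 s T (Q : state -> Prop) :
  loop_free c1 -> runs c2 (run c1 s) T Q -> runs (c1 ;; c2) s (run_time c1 + T) Q.
Proof. by move=> lf1 run2; apply: runs_seq; apply: runs_loop_free. Qed.

(** * Frame conditions: memory that a program leaves alone *)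

Fixpoint written_regs c : seq nat :=
  match c with
  | Const r _ | Move r _ | Succ r _ | Defs.Sub r _ _ | Read r _ _ => [:: r]
  | Skip | Write _ _ _ => [::]
  | c1 ;; c2 | IfLt _ _ c1 c2 => written_regs c1 ++ written_regs c2
  | WhileLt _ _ c => written_regs c
  end.

Fixpoint written_arrs c : seq nat :=
  match c with
  | Write a _ _ => [:: a]
  | c1 ;; c2 | IfLt _ _ c1 c2 => written_arrs c1 ++ written_arrs c2
  | WhileLt _ _ c => written_arrs c
  | _ => [::]
  end.

Definition unchanged (c : cmd) (s s' : state) : Prop :=
  (forall r, r \notin written_regs c -> reg s' r = reg s r) /\
  (forall a, a \notin written_arrs c -> arr s' a = arr s a).

Lemma unchanged_trans c s1 s2 s3 :
  unchanged c s1 s2 -> unchanged c s2 s3 -> unchanged c s1 s3.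
Proof.
move=> [r12 a12] [r23 a23]; split=> [r nr | a na]; first by rewrite r23 ?r12.
by rewrite a23 ?a12.
Qed.

Lemma unchanged_sub c c' s s' :
  {subset written_regs c <= written_regs c'} ->
  {subset written_arrs c <= written_arrs c'} ->
  unchanged c s s' -> unchanged c' s s'.
Proof.
move=> subr suba [eqr eqa]; split=> [r nr | a na].
  by apply: eqr; apply: contra nr; apply: subr.
by apply: eqa; apply: contra na; apply: suba.
Qed.

Lemma exec_unchanged c s t s' : exec c s t s' -> unchanged c s s'.
Proof.
elim=> {c s t s'} //.
1-5: by move=> *; split=> // r; rewrite inE /= /update => /negbTE->.
- by move=> a p q s; split=> // b; rewrite inE /= => /negbTE->.
- move=> c1 c2 s1 t1 s2 t2 s3 _ un1 _ un2; apply: unchanged_trans.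
    by apply: unchanged_sub un1 => x; rewrite /= mem_cat => ->.
  by apply: unchanged_sub un2 => x; rewrite /= mem_cat orbC => ->.
- move=> p q c1 c2 s t s' _ _; apply: unchanged_sub => x;
  by rewrite /= mem_cat => ->.
- move=> p q c1 c2 s t s' _ _; apply: unchanged_sub => x;
  by rewrite /= mem_cat orbC => ->.
by move=> p q c s1 t1 s2 t2 s3 _ _ un1 _ un2; apply: unchanged_trans un1 un2.
Qed.

Lemma run_unchanged c s : loop_free c -> unchanged c s (run c s).
Proof.
move=> lfc; have [t [s' [ex _ <-]]] : runs c s (run_time c) (eq^~ (run c s)).
  exact: runs_loop_free.
exact: exec_unchanged ex.
Qed.

Lemma runs_unchanged c s T (Q Q' : state -> Prop) :
  runs c s T Q -> (forall s', unchanged c s s' -> Q s' -> Q' s') -> runs c s T Q'.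
Proof.
move=> [t [s' [ex le_tT Qs']]] QQ'; exists t, s'; split=> //.
by apply: QQ' Qs'; apply: exec_unchanged ex.
Qed.

(** * Rules for counting loops and list traversals *)

Definition for_loop (i m : nat) (body : cmd) : cmd :=
  Const i 0 ;; WhileLt i m (body ;; Succ i i).

(** The counter is set outside [body], so the invariant has to survive any change to it. A turn pays
    2 extra steps, for the test and the increment; the last 2 are the initialisation and the final
    test. *)
Lemma runs_for (n i m : nat) body (I : nat -> state -> Prop) (cost : 'I_n -> nat) s :
  i != m -> i \notin written_regs body -> m \notin written_regs body ->
  reg s m = n ->
  (forall k s1 v, I k s1 -> I k (set_reg s1 i v)) ->
  I 0 s ->
  (forall (k : 'I_n) s1, unchanged (for_loop i m body) s s1 -> reg s1 i = k ->
     I k s1 -> runs body s1 (cost k) (I k.+1)) ->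
  runs (for_loop i m body) s (\sum_k (cost k + 2) + 2) (I n).
Proof.
move=> neq_im i_body m_body sm I_reg I0 I_step.
have m_for : m \notin written_regs (for_loop i m body).
  by rewrite /= inE mem_cat inE !negb_or m_body (eq_sym m) neq_im.
have un_i s1 v : unchanged (for_loop i m body) s1 (set_reg s1 i v).
  by split=> // r; rewrite /= inE negb_or /update => /andP[/negbTE->].
(* Here [d] is the number of turns still to come, and the sum over [drop k (enum 'I_n)] is their
   cost. *)
suff loop d k s1 : k + d = n -> unchanged (for_loop i m body) s s1 -> reg s1 i = k ->
    I k s1 -> runs (WhileLt i m (body ;; Succ i i)) s1
                (\sum_(x <- drop k (enum 'I_n)) (cost x + 2) + 1) (I n).
  apply: (@runs_weaken _ _ (1 + (\sum_(x <- drop 0 (enum 'I_n)) (cost x + 2) + 1))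
    _ (I n)) => //; last first.
    by rewrite drop0 big_enum add1n addn1 addn2.
  apply: runs_seq; apply: runs_loop_free => //=; apply: (loop n 0) => //.
    by rewrite /= /update eqxx.
  exact: I_reg.
elim: d k s1 => [|d IHd] k s1 def_n un1 s1i Ik.
  rewrite addn0 in def_n; apply: runs_while_done; rewrite ?addn1 //.
    by rewrite (un1.1 m) // sm s1i def_n.
  by rewrite -def_n.
have lt_kn : k < n by rewrite -def_n addnS ltnS leq_addr.
rewrite (drop_nth (Ordinal lt_kn)) ?size_enum_ord // big_cons.
rewrite -[k in nth _ _ k]/(nat_of_ord (Ordinal lt_kn)) nth_ord_enum.
apply: (@runs_weaken _ _ ((cost (Ordinal lt_kn) + 1) +
    (\sum_(x <- drop k.+1 (enum 'I_n)) (cost x + 2) + 1)).+1 _ (I n)) => //; last first.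
  by rewrite !addnA !addn1 !addn2 !addSn.
apply: runs_while_step; first by rewrite s1i (un1.1 m) // sm.
apply: runs_seq.
apply: runs_unchanged (I_step (Ordinal lt_kn) s1 un1 s1i Ik) _ => s2 un2 Ik1.
apply: runs_loop_free => //=; apply: IHd; rewrite ?addSnnS //.
- apply: unchanged_trans un1 _; apply: unchanged_trans (un_i _ _).
  by apply: unchanged_sub un2 => x xP; rewrite /= ?inE ?mem_cat xP ?orbT.
- by rewrite /= /update eqxx un2.1 // s1i.
exact: I_reg.
Qed.

(** Register [z] is meant to hold 0, so the loop test asks whether the address in [p] is not
    null. *)
Definition list_loop (z a i p v : nat) (body : cmd) : cmd :=
  Read p a i ;; WhileLt z p (Read v a.+1 p ;; body ;; Read p a.+2 p).

(** The invariant speaks of the prefix already read. As [body] does not write the cell arrays, the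
    unread suffix stays as it was in [s]. A turn pays 3 extra steps: the test and two reads. *)
Lemma runs_list (n z a i p v : nat) body (I : seq 'I_n -> state -> Prop)
    (cost : 'I_n -> nat) (l : seq 'I_n) s :
  uniq [:: z; p; v] -> z \notin written_regs body -> p \notin written_regs body ->
  a.+1 \notin written_arrs body -> a.+2 \notin written_arrs body ->
  reg s z = 0 ->
  linked_list (arr s a.+1) (arr s a.+2) (arr s a (reg s i)) (map val l) ->
  (forall l1 s1 r k, r \in [:: p; v] -> I l1 s1 -> I l1 (set_reg s1 r k)) ->
  I [::] s ->
  (forall l1 x l2 s1, l = l1 ++ x :: l2 ->
     unchanged (list_loop z a i p v body) s s1 -> reg s1 v = x ->
     I l1 s1 -> runs body s1 (cost x) (I (rcons l1 x))) ->
  runs (list_loop z a i p v body) s (\sum_(x <- l) (cost x + 3) + 2) (I l).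
Proof.
rewrite /= !inE negb_or andbT => /andP[/andP[neq_zp neq_zv] neq_pv] z_body p_body.
move=> a1_body a2_body sz0 sl I_reg I0 I_step.
set c := list_loop z a i p v body in I_step *.
have z_c : z \notin written_regs c.
  by rewrite /c /= !in_cons mem_cat mem_seq1 !negb_or neq_zp neq_zv z_body.
have a1_c : a.+1 \notin written_arrs c by rewrite /c /= cats0.
have a2_c : a.+2 \notin written_arrs c by rewrite /c /= cats0.
have un_p s1 k : unchanged c s1 (set_reg s1 p k).
  by split=> // r; rewrite /c /= inE negb_or /update => /andP[/negbTE->].
have un_v s1 k : unchanged c s1 (set_reg s1 v k).
  by split=> // r; rewrite /c /= !inE !negb_or /update => /and3P[_ /negbTE->].
suff loop l2 l1 s1 : l = l1 ++ l2 -> unchanged c s s1 ->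
    linked_list (arr s a.+1) (arr s a.+2) (reg s1 p) (map val l2) -> I l1 s1 ->
    runs (WhileLt z p (Read v a.+1 p ;; body ;; Read p a.+2 p)) s1
      (\sum_(x <- l2) (cost x + 3) + 1) (I l).
  apply: (@runs_weaken _ _ (1 + (\sum_(x <- l) (cost x + 3) + 1)) _ (I l)) => //; last first.
    by rewrite add1n addn1 addn2.
  apply: runs_seq; apply: runs_loop_free => //=; apply: (loop l [::]) => //.
    by rewrite /= /update eqxx.
  by apply: I_reg; rewrite ?mem_head.
elim: l2 l1 s1 => [|x l2 IHl] l1 s1 def_l un1 sl1 Il1.
  apply: runs_while_done; rewrite ?addn1 //; first by rewrite (un1.1 z) // sz0 sl1.
  by rewrite def_l cats0.
rewrite big_cons; case: sl1 => p_gt0 data_p sl2.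
apply: (@runs_weaken _ _ ((1 + (cost x + 1)) +
    (\sum_(x <- l2) (cost x + 3) + 1)).+1 _ (I l)) => //; last by lia.
apply: runs_while_step; first by rewrite (un1.1 z) // sz0.
apply: runs_seq; apply: runs_loop_free => //; apply: runs_seq.
rewrite [run _ _]/=; set s2 := set_reg _ _ _.
have un2 : unchanged c s s2 by apply: unchanged_trans un1 (un_v _ _).
have Il2 : I l1 s2 by apply: I_reg; rewrite // !inE eqxx orbT.
have s2v : reg s2 v = x by rewrite /= /update eqxx un1.2.
apply: runs_unchanged (I_step l1 x l2 s2 def_l un2 s2v Il2) _ => s3 un3 Il3.
have s3p : reg s3 p = reg s1 p by rewrite un3.1 //= /update (negbTE neq_pv).
have {}un3 : unchanged c s s3.
  apply: unchanged_trans un2 _; apply: unchanged_sub un3 => y yP;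
  by rewrite /c /= ?inE ?mem_cat yP ?orbT.
apply: runs_loop_free => //=; apply: (IHl (rcons l1 x)).
- by rewrite cat_rcons.
- exact: unchanged_trans un3 (un_p _ _).
- by rewrite /= /update eqxx un3.2 // s3p.
by apply: I_reg; rewrite ?mem_head.
Qed.

(** * The program *)

Local Notation rN := 0 (only parsing).
Local Notation rWidth := 1 (only parsing).
Local Notation rZero := 2 (only parsing).
Local Notation rOne := 3 (only parsing).
Local Notation rHeight := 4 (only parsing).
Local Notation rDeg := 5 (only parsing).
Local Notation rBucket := 6 (only parsing).
Local Notation rV := 7 (only parsing).
Local Notation rCell := 8 (only parsing).
Local Notation rU := 9 (only parsing).
Local Notation rAcc := 10 (only parsing).
Local Notation rTmp := 11 (only parsing).
Local Notation rTmp' := 12 (only parsing).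

Local Notation aAdj := 0 (only parsing).
Local Notation aOut := 3 (only parsing).
Local Notation aDeg := 6 (only parsing).
Local Notation aLayer := 9 (only parsing).
Local Notation aSize := 10 (only parsing).

Definition for_vertices := for_loop rV rN.
Definition for_neighbours := list_loop rZero aAdj rV rCell rU.

(* The cell of vertex [v] has address [v.+1]. *)
Definition insert (a : nat) : cmd :=
  Succ rTmp rV ;; Write a.+1 rTmp rV ;; Read rTmp' a rAcc ;;
  Write a.+2 rTmp rTmp' ;; Write a rAcc rTmp.

Definition initialize : cmd :=
  Const rWidth 0 ;; Const rZero 0 ;; Const rOne 1 ;; Const rHeight 0 ;;
  for_vertices (Write aOut rV rZero ;; Write aDeg rV rZero ;; Write aSize rV rZero).

(* As [D] is transitive, an arc [v -> w] forces [outdeg w < outdeg v], so bucket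
   sort by out-degree puts every vertex after its out-neighbours. *)
Definition sort_by_outdeg : cmd :=
  for_vertices (
    Const rAcc 0 ;;
    for_neighbours (Succ rAcc rAcc) ;;
    insert aDeg).

(** Evaluates the recurrence [layerE], once [aLayer] is correct on the out-neighbours. *)
Definition find_layer : cmd :=
  Const rAcc 0 ;;
  for_neighbours (
    Read rTmp aLayer rU ;; Succ rTmp rTmp ;; IfLt rAcc rTmp (Move rAcc rTmp) Skip).

Definition add_to_layer : cmd :=
  Write aLayer rV rAcc ;;
  insert aOut ;;
  Read rTmp aSize rAcc ;; Succ rTmp rTmp ;; Write aSize rAcc rTmp ;;
  Succ rTmp rAcc ;; IfLt rHeight rTmp (Move rHeight rTmp) Skip.

Definition find_layers : cmd :=
  for_loop rDeg rN (list_loop rZero aDeg rDeg rBucket rV (find_layer ;; add_to_layer)).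

(* The out-neighbours of the vertex are taken out of the layer sizes, so that the
   scan stops at the first layer with a vertex that is not an out-neighbour; the
   layers it skips are nonempty sets of out-neighbours, which pays for it. *)
Definition find_width : cmd :=
  for_vertices (
    for_neighbours (
      Read rTmp aLayer rU ;; Read rTmp' aSize rTmp ;; Defs.Sub rTmp' rTmp' rOne ;;
      Write aSize rTmp rTmp') ;;
    Const rAcc 0 ;; Read rTmp aSize rAcc ;;
    WhileLt rTmp rOne (Succ rAcc rAcc ;; Read rTmp aSize rAcc) ;;
    Read rTmp aLayer rV ;; Defs.Sub rTmp rTmp rAcc ;;
    IfLt rWidth rTmp (Move rWidth rTmp) Skip ;;
    for_neighbours (
      Read rTmp aLayer rU ;; Read rTmp' aSize rTmp ;; Succ rTmp' rTmp' ;;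
      Write aSize rTmp rTmp')).

Definition layers_program : cmd :=
  initialize ;; sort_by_outdeg ;; find_layers ;; find_width ;; Move rN rHeight.

(* Unlike [linked_list], the cells have prescribed addresses, so that lists
   without a common element are disjoint in memory. *)
Fixpoint vertex_list (data next : nat -> nat) (p : nat) (l : seq nat) : Prop :=
  if l is x :: l' then
    [/\ p = x.+1, data p = x & vertex_list data next (next p) l']
  else p = 0.

Lemma vertex_list_linked data next p l :
  vertex_list data next p l -> linked_list data next p l.
Proof. by elim: l p => //= x l IHl p [-> eq_x /IHl]. Qed.

(** The cell at [x.+1] belongs to [x] alone, so a list without [x] does not pass through it. *)
Lemma vertex_list_update data next p l x y z :
  x \notin l -> vertex_list data next p l ->
  vertex_list (update data x.+1 y) (update next x.+1 z) p l.
Proof.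
elim: l p => //= u l IHl p; rewrite inE negb_or => /andP[neq_xu xl] [-> eq_u ll].
by rewrite /update eqSS eq_sym (negbTE neq_xu); split=> //; apply: IHl.
Qed.

(** * Correctness and running time of each phase *)

Section Correctness.
Variables (n : nat) (D : rel 'I_n).
Hypothesis ordD : strict_order D.
Notation outdeg := (outdeg D).
Notation layer := (layer D).
Local Notation arcs := (number_of_arcs D).
Notation layered A j := #|[set x in A | layer x == j]|.

Definition ready s : Prop :=
  [/\ reg s rN = n, reg s rZero = 0, reg s rOne = 1
    & holds_sets s aAdj (fun v => [set w | D v w])].

Lemma ready_unchanged c s s' :
  all (fun r => r \notin written_regs c) [:: rN; rZero; rOne] ->
  all (fun a => a \notin written_arrs c) [:: aAdj; aAdj.+1; aAdj.+2] ->
  unchanged c s s' -> ready s -> ready s'.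
Proof.
case/and4P=> r0 r2 r3 _ /and4P[a0 a1 a2 _] [eqr eqa] [sN sZ sO adj].
split; rewrite ?eqr // => v.
by have [l lv ll] := adj v; exists l; rewrite ?eqa.
Qed.

(** The order of [L] matters: [insert] pushes at the front, so [L] starts with the vertex inserted
    last. *)
Definition buckets s a (key : 'I_n -> nat) (L : seq 'I_n) : Prop :=
  forall j, j < n -> vertex_list (arr s a.+1) (arr s a.+2) (arr s a j)
                       (map val [seq x <- L | key x == j]).

(** [A] is the set currently counted, which [find_width] shrinks and restores. *)
Definition counts s (A : {set 'I_n}) : Prop :=
  forall j, j < n -> arr s aSize j = layered A j.

Lemma layer_lt_n x : layer x < n.
Proof.
by apply: leq_ltn_trans (layer_le_outdeg ordD x) _; rewrite -[ltnRHS]card_ord outdeg_lt_card.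
Qed.

Lemma insert_buckets a (key : 'I_n -> nat) (x : 'I_n) L s :
  x \notin L -> reg s rV = x -> reg s rAcc = key x -> buckets s a key L ->
  buckets (run (insert a) s) a key (x :: L).
Proof.
move=> xL sv sacc bL j lt_jn; have ll := bL j lt_jn.
have e1 : (a == a.+1) = false by lia.
have e2 : (a == a.+2) = false by lia.
have e3 : (a.+1 == a) = false by lia.
have e4 : (a.+2 == a) = false by lia.
have e5 : (a.+2 == a.+1) = false by lia.
have e6 : (a.+1 == a.+2) = false by lia.
rewrite /= /update /= !(eqxx, e1, e2, e3, e4, e5, e6, sv, sacc) /=.
have xj : val x \notin map val [seq y <- L | key y == j].
  by rewrite (mem_map val_inj) mem_filter negb_and xL orbT.
rewrite [key x == j]eq_sym; case: eqP => [def_j|_]; last exact: vertex_list_update.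
rewrite /= -def_j; split=> //; rewrite ?eqxx //.
exact: vertex_list_update.
Qed.

Lemma sum_affine a b : \sum_x (a * outdeg x + b) = a * arcs + b * n.
Proof.
by rewrite big_split /= -big_distrr sum_outdeg sum_nat_const card_ord mulnC.
Qed.

(** With a constant cost per neighbour the traversal is linear in the out-degree. The unknown order
    of the adjacency list is hidden in the enumeration [l]. *)
Lemma runs_neighbours body (I : seq 'I_n -> state -> Prop) cost (v : 'I_n) s
    (Q : state -> Prop) :
  rZero \notin written_regs body -> rCell \notin written_regs body ->
  all (fun a => a \notin written_arrs body) [:: 1; 2] ->
  (forall l s1 r k, r \in [:: rCell; rU] -> I l s1 -> I l (set_reg s1 r k)) ->
  ready s -> reg s rV = v -> I [::] s ->
  (forall l x s1, x \notin l -> D v x -> unchanged (for_neighbours body) s s1 ->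
     reg s1 rU = x -> I l s1 -> runs body s1 cost (I (rcons l x))) ->
  (forall l s1, uniq l -> l =i [set w | D v w] -> unchanged (for_neighbours body) s s1 ->
     I l s1 -> Q s1) ->
  runs (for_neighbours body) s ((cost + 3) * outdeg v + 2) Q.
Proof.
move=> z_body p_body /and3P[a1 a2 _] I_reg [sN sZ sO adj] sv I0 I_step I_end.
have [l [uniq_l mem_l] ll] := adj v.
have size_l : size l = outdeg v by rewrite -(card_uniqP uniq_l) (eq_card mem_l).
apply: (@runs_unchanged _ _ _ (I l)) => [|s1 un1 Il]; last exact: I_end un1 Il.
apply: (@runs_weaken _ _ (\sum_(x <- l) (cost + 3) + 2) _ (I l)) => //; last first.
  by rewrite big_const_seq count_predT iter_addn_0 size_l.
apply: runs_list => //; first by rewrite sv.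
move=> l1 x l2 s1 def_l un1 s1u; apply: I_step => //.
  by move: uniq_l; rewrite def_l cat_uniq /= negb_or => /and3P[_ /andP[]].
by have := mem_l x; rewrite def_l mem_cat mem_head orbT inE => /esym.
Qed.

Lemma layered_add (v : 'I_n) (A : {set 'I_n}) j :
  v \notin A -> layered (v |: A) j = (layer v == j) + layered A j.
Proof.
move=> vA; case: eqP => [lvj|neq_lvj].
  have -> : [set x in v |: A | layer x == j] = v |: [set x in A | layer x == j].
    by apply/setP => x; rewrite !inE; case: eqP => // ->; rewrite lvj eqxx.
  by rewrite cardsU1 inE (negbTE vA).
apply: eq_card => x; rewrite !inE; case: eqP => // ->.
by rewrite (negbTE vA) /=; apply/eqP.
Qed.

Lemma initialize_correct s :
  input_adjacency_lists D s ->
  runs initialize s (5 * n + 6) (fun s' => [/\ ready s', buckets s' aOut layer [::],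
    buckets s' aDeg outdeg [::], counts s' set0 & reg s' rHeight = 0 /\ reg s' rWidth = 0]).
Proof.
move=> [sN adj]; eapply runs_leq.
  do 4! [apply: runs_step => //].
  apply: (@runs_unchanged _ _ _ (fun s' => forall j, j < n ->
    [/\ arr s' aOut j = 0, arr s' aDeg j = 0 & arr s' aSize j = 0])).
  apply: (@runs_for n _ _ _ (fun k s' => forall j, j < k ->
    [/\ arr s' aOut j = 0, arr s' aDeg j = 0 & arr s' aSize j = 0]) (fun=> 3)) => //.
    move=> k s1 [un_r _] s1v Ik; apply: runs_loop_free => // j.
    rewrite ltnS /= /update /= s1v (un_r rZero) //=; case: eqP => // neq_jk le_jk.
    by apply: Ik; rewrite ltn_neqAle le_jk andbT; apply/eqP.
  move=> s' [un_r un_a] zeros; split.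
  - by split; rewrite ?un_r //= => v; have [l lv ll] := adj v; exists l; rewrite ?un_a.
  - by move=> j /zeros[].
  - by move=> j /zeros[].
  - by move=> j /zeros[_ _ ->]; apply/esym/eqP; rewrite cards_eq0; apply/eqP/setP => x; rewrite !inE.
  - by rewrite !un_r.
by rewrite sum_nat_const card_ord /=; lia.
Qed.

Lemma sort_by_outdeg_correct s :
  ready s -> buckets s aDeg outdeg [::] ->
  runs sort_by_outdeg s (4 * arcs + 11 * n + 2) (fun s' => exists L,
    [/\ uniq L, L =i predT & buckets s' aDeg outdeg L]).
Proof.
move=> rs b0; eapply runs_leq.
  apply: (@runs_weaken _ _ _ _ (fun s' => exists L,
    [/\ uniq L, L =i (fun x : 'I_n => x < n) & buckets s' aDeg outdeg L])); last first.
  - by move=> s' [L [uL memL bL]]; exists L; split=> // x; rewrite memL; apply: ltn_ord.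
  - exact: leqnn.
  apply: (@runs_for n _ _ _ (fun k s' => exists L,
    [/\ uniq L, L =i (fun x : 'I_n => x < k) & buckets s' aDeg outdeg L])
    (fun x => 4 * outdeg x + 9)) => //.
  - by case: rs.
  - by exists [::].
  move=> x s1 un1 s1v [L [uL memL bL]].
  have rs1 : ready s1 by apply: ready_unchanged un1 rs.
  eapply runs_leq.
    apply: runs_step => //; apply: runs_seq.
    apply: (@runs_neighbours _ (fun l s' => reg s' rAcc = size l) 1 x) => //.
    + by move=> l s2 r k; rewrite !inE => /orP[] /eqP->.
    + by move=> l y s2 _ _ _ _ s2acc; apply: runs_loop_free => //=; rewrite s2acc size_rcons.
    move=> l s2 uniq_l mem_l un2 s2acc; apply: runs_loop_free => //.
    have xL : x \notin L by rewrite memL unfold_in ltnn.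
    exists (x :: L); split.
    + by rewrite /= xL.
    + by move=> y; rewrite in_cons memL -val_eqE !unfold_in ltnS [RHS]leq_eqVlt.
    apply: insert_buckets => //; first by rewrite un2.1 /=.
      by rewrite s2acc -(card_uniqP uniq_l) (eq_card mem_l).
    by move=> j /bL; rewrite !un2.2.
  by rewrite /=; lia.
by rewrite big_split /= sum_affine sum_nat_const card_ord; lia.
Qed.

(** The state between two vertices of [find_layers]; [L] contains the vertices treated so far, the
    latest first. *)
Definition assigned s (L : seq 'I_n) : Prop :=
  [/\ buckets s aOut layer L, forall x, x \in L -> arr s aLayer x = layer x,
      counts s [set x in L] & reg s rHeight = \max_(x <- L) (layer x).+1].

Lemma find_layer_correct s (v : 'I_n) :
  ready s -> reg s rV = v -> (forall w, D v w -> arr s aLayer w = layer w) ->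
  runs find_layer s (8 * outdeg v + 3) (fun s' => reg s' rAcc = layer v).
Proof.
move=> rs sv lay; eapply runs_leq.
  apply: runs_step => //.
  apply: (@runs_neighbours _ (fun l s' => reg s' rAcc = \max_(x <- l) (layer x).+1) 5 v) => //.
  - by move=> l s2 r k; rewrite !inE => /orP[] /eqP->.
  - by rewrite big_nil.
  - move=> l x s1 _ Dvx un1 s1u s1acc; apply: runs_loop_free => //=.
    rewrite /update /= s1u un1.2 //= lay // s1acc big_rcons /=.
    by case: ltnP => cmp; rewrite /= /update /= ?s1acc; lia.
  move=> l s1 uniq_l mem_l _ ->; rewrite layerE // -[RHS]big_filter.
  apply: perm_big; apply: uniq_perm => //.
    by rewrite filter_uniq ?index_enum_uniq.
  by move=> x; rewrite mem_l mem_filter mem_index_enum inE andbT.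
by rewrite /=; lia.
Qed.

Lemma add_to_layer_correct s L (v : 'I_n) :
  ready s -> reg s rV = v -> reg s rAcc = layer v -> v \notin L -> assigned s L ->
  runs add_to_layer s 13 (fun s' => assigned s' (v :: L)).
Proof.
move=> rs sv sacc vL [bL lay cnt hgt]; 
apply: (@runs_leq _ _ (run_time add_to_layer)) => //.
apply: (@runs_step _ _ _ 12) => //; set s1 := run _ _.
have s1lay x : x \in v :: L -> arr s1 aLayer x = layer x.
  rewrite inE /= /update sv sacc -val_eqE.
  by case: eqVneq => [/val_inj-> //|_ /= /lay].
apply: (@runs_step _ _ _ 7) => //; set s2 := run _ _.
have [un_r un_a] : unchanged (insert aOut) s1 s2 by apply: run_unchanged.
have bvL : buckets s2 aOut layer (v :: L) by apply: insert_buckets.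
have s2lay x : x \in v :: L -> arr s2 aLayer x = layer x by rewrite un_a //; apply: s1lay.
have s2cnt : counts s2 [set x in L] by move=> j /cnt <-; rewrite un_a.
have s2acc : reg s2 rAcc = layer v by rewrite un_r.
have s2hgt : reg s2 rHeight = \max_(x <- L) (layer x).+1 by rewrite un_r.
(* Forgetting how the state arose keeps the evaluation of the remaining commands small. *)
move: (s2) bvL s2lay s2cnt s2acc s2hgt => {un_r un_a}s3 bvL s3lay s3cnt s3acc s3hgt.
apply: runs_loop_free => //; set s4 := run _ _.
have [un_r un_a] := @run_unchanged (Read rTmp aSize rAcc ;; Succ rTmp rTmp ;; Write aSize rAcc rTmp ;;
  Succ rTmp rAcc ;; IfLt rHeight rTmp (Move rHeight rTmp) Skip) s3 isT.
split.
- by move=> j /bvL; rewrite !un_a.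
- by move=> x /s3lay; rewrite un_a.
- have s4cnt : arr s4 aSize = update (arr s3 aSize) (layer v) (arr s3 aSize (layer v)).+1.
    by rewrite /s4 /=; case: ltnP => _; rewrite /= /update /= s3acc.
  move=> j lt_jn; rewrite s4cnt set_cons layered_add ?inE // -s3cnt // /update eq_sym.
  by case: eqP => // ->.
rewrite big_cons -s3hgt /s4 /=; set b := (_ < _); have -> : b = (reg s3 rHeight < (layer v).+1).
  by rewrite /b /update /= s3acc.
by case: ltnP => cmp; rewrite /= /update /= ?s3acc; lia.
Qed.

(** When bucket [d] is reached, the vertices of out-degree below [d] have their layers, and the
    out-neighbours of any vertex in the bucket are among them. *)
Lemma find_layers_correct s L0 :
  ready s -> uniq L0 -> L0 =i predT -> buckets s aDeg outdeg L0 ->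
  assigned s [::] ->
  runs find_layers s (8 * arcs + 23 * n + 2) (fun s' => exists L,
    [/\ uniq L, L =i predT & assigned s' L]).
Proof.
move=> rs uL0 memL0 b0 as0; eapply runs_leq.
  apply: (@runs_weaken _ _ _ _ (fun s' => exists L,
    [/\ uniq L, L =i (fun x : 'I_n => outdeg x < n) & assigned s' L])); last first.
  - move=> s' [L [uL memL bL]]; exists L; split=> // x; rewrite memL unfold_in.
    by rewrite -[ltnRHS]card_ord outdeg_lt_card.
  - exact: leqnn.
  apply: (@runs_for n _ _ _ (fun d s' => exists L,
    [/\ uniq L, L =i (fun x : 'I_n => outdeg x < d) & assigned s' L])
    (fun d => \sum_(x <- [seq x <- L0 | outdeg x == d]) (8 * outdeg x + 19) + 2)) => //.
  - by case: rs.
  - by exists [::].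
  move=> d s1 un1 s1d [L [uL memL aL]].
  have rs1 : ready s1 by apply: ready_unchanged un1 rs.
  set B := [seq x <- L0 | outdeg x == d].
  eapply runs_leq.
    (* The vertices of the bucket are put in front one by one, hence the reversal. *)
    apply: (@runs_weaken _ _ _ _ (fun s' => assigned s' (rev B ++ L))); last first.
    + move=> s2 as2; exists (rev B ++ L); split=> //.
        rewrite cat_uniq rev_uniq filter_uniq // uL andbT; apply/hasPn => x.
        by rewrite memL unfold_in mem_rev mem_filter; case: ltngtP.
      by move=> x; rewrite mem_cat mem_rev mem_filter (memL0 x) andbT memL
           !unfold_in ltnS [RHS]leq_eqVlt.
    + exact: leqnn.
    apply: (@runs_list _ _ _ _ _ _ _ (fun l s' => assigned s' (rev l ++ L))
      (fun x => 8 * outdeg x + 16) B) => //.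
    + by case: rs1.
    + by rewrite !un1.2 // s1d; apply/vertex_list_linked/b0.
    + by move=> l s2 r k; rewrite !inE => /orP[] /eqP->.
    move=> l1 x l2 s2 def_B un2 s2v as2.
    have rs2 : ready s2 by apply: ready_unchanged un2 rs1.
    have xB : x \in B by rewrite def_B mem_cat mem_head orbT.
    have /eqP degx : outdeg x == d by move: xB; rewrite mem_filter => /andP[].
    rewrite rev_rcons -[16]/(3 + 13) addnA; apply: runs_seq.
    apply: runs_unchanged (find_layer_correct rs2 s2v _) _ => [w Dxw|s3 un3 s3acc].
      case: as2 => _ lay _ _; apply: lay; rewrite mem_cat; apply/orP; right.
      by rewrite memL unfold_in -degx; apply: outdeg_lt.
    apply: add_to_layer_correct => //.
    + by apply: ready_unchanged un3 rs2.
    + by rewrite un3.1.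
    + rewrite mem_cat mem_rev memL [X in _ || X]unfold_in degx ltnn orbF.
      have : uniq B by rewrite filter_uniq.
      by rewrite def_B cat_uniq /= negb_or => /and3P[_ /andP[]].
    have [bL lay cnt hgt] := as2; split; rewrite ?un3.1 //.
    + by move=> j /bL; rewrite !un3.2.
    + by move=> y /lay; rewrite un3.2.
    by move=> j /cnt; rewrite un3.2.
  by rewrite leq_add2r; apply: leq_sum => x _; rewrite -addnA.
rewrite (eq_bigr (fun d : 'I_n => (\sum_(x <- L0 | outdeg x == d) (8 * outdeg x + 19)) + 4)).
  rewrite big_split /= sum_nat_const card_ord.
  (* Each vertex lies in exactly one bucket, so exchanging the sums charges it once. *)
  have -> : \sum_(d < n) \sum_(x <- L0 | outdeg x == d) (8 * outdeg x + 19) = 8 * arcs + 19 * n.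
    rewrite -sum_affine (exchange_big_dep predT) //=.
    rewrite -[RHS]big_enum; transitivity (\sum_(x <- L0) (8 * outdeg x + 19)).
      apply: eq_bigr => x _.
      have lt_xn : outdeg x < n by rewrite -[ltnRHS]card_ord outdeg_lt_card.
      by rewrite (big_pred1 (Ordinal lt_xn)) // => d; rewrite -val_eqE eq_sym.
    apply: perm_big; apply: uniq_perm; rewrite ?enum_uniq // => x.
    by rewrite memL0 mem_enum.
  lia.
by move=> d _; rewrite big_filter -addnA.
Qed.

(** A counter at 0 means that its layer consists of out-neighbours of [v]. The scan stops at the
    layer of [v] at the latest, as [v] is not its own out-neighbour. *)
Lemma scan_correct s (v : 'I_n) :
  reg s rOne = 1 -> counts s [set w | ~~ D v w] ->
  reg s rTmp = arr s aSize (reg s rAcc) -> reg s rAcc <= layer v ->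
  (forall y, layer y < reg s rAcc -> D v y) ->
  runs (WhileLt rTmp rOne (Succ rAcc rAcc ;; Read rTmp aSize rAcc)) s
    (3 * layer v + 1) (fun s' => reach D v = layer v - reg s' rAcc).
Proof.
move: {2}(layer v - reg s rAcc) (erefl (layer v - reg s rAcc)) => m.
move=> def_m sO cnt sT le_acc below.
apply: (@runs_leq _ _ (3 * m + 1)); last by lia.
elim/ltn_ind: m s def_m sO cnt sT le_acc below => m IHm s def_m sO cnt sT le_acc below.
have size_acc := cnt _ (leq_ltn_trans le_acc (layer_lt_n v)); rewrite -sT in size_acc.
have [size0 | size_gt0] := posnP (reg s rTmp); last first.
  apply: runs_while_done; rewrite ?addn1 ?sO //; apply: reachE => //.
  move: size_gt0; rewrite size_acc => /card_gt0P[y]; rewrite !inE => /andP[nDvy /eqP ly].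
  by exists y.
have below_acc y : layer y <= reg s rAcc -> D v y.
  rewrite leq_eqVlt => /predU1P[ly|]; last exact: below.
  move/eqP: size0; rewrite size_acc cards_eq0 => /eqP/setP/(_ y).
  by rewrite !inE ly eqxx andbT => /negbFE.
have lt_acc : reg s rAcc < layer v.
  by rewrite ltnNge; apply/negP => /below_acc; rewrite ordD.1.
apply: (@runs_leq _ _ (2 + (3 * (layer v - (reg s rAcc).+1) + 1)).+1); last by lia.
apply: runs_while_step; first by rewrite size0 sO.
by apply: runs_loop_free => //; apply: IHm => //; rewrite -def_m ltn_sub2l.
Qed.

(** The counters are restored after each vertex, so the full layer sizes are part of the invariant.
    The two traversals cost 7 steps each per out-neighbour and the scan at most 3 more, whence
    17. *)
Lemma find_width_correct s :
  ready s -> reg s rWidth = 0 -> (forall x : 'I_n, arr s aLayer x = layer x) ->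
  counts s setT ->
  runs find_width s (17 * arcs + 17 * n + 2) (fun s' => reg s' rWidth = \max_x reach D x).
Proof.
move=> rs sW lay cnt; eapply runs_leq.
  apply: (@runs_weaken _ _ _ _ (fun s' => counts s' setT /\
    reg s' rWidth = \max_(x : 'I_n | x < n) reach D x)); last first.
  - by move=> s' [_ ->]; apply: eq_bigl => x; rewrite ltn_ord.
  - exact: leqnn.
  apply: (@runs_for n _ _ _ (fun k s' => counts s' setT /\
    reg s' rWidth = \max_(x : 'I_n | x < k) reach D x) (fun x => 17 * outdeg x + 15)) => //.
  - by case: rs.
  - by rewrite big_pred0.
  move=> x s1 un1 s1v [cnt1 s1W].
  have rs1 : ready s1 by apply: ready_unchanged un1 rs.
  have lay1 (y : 'I_n) : arr s1 aLayer y = layer y by rewrite un1.2.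
  (* Turns the time of the scan, linear in the layer of [x], into one linear in its out-degree. *)
  have size_deg := layer_le_outdeg ordD x.
  eapply runs_leq.
    apply: runs_seq.
    apply: (@runs_neighbours _ (fun l s' => counts s' (~: [set y in l])) 4 x) => //.
    + by move=> j lt_jn; rewrite cnt1 //; apply: eq_card => y; rewrite !inE.
    + move=> l y s2 yl _ un2 s2u cnt2; apply: runs_loop_free => // j lt_jn.
      have s2O : reg s2 rOne = 1 by rewrite un2.1; case: rs1.
      rewrite /= /update /= s2u (un2.2 aLayer) // lay1 s2O.
      have -> : ~: [set z in rcons l y] = (~: [set z in l]) :\ y.
        by apply/setP => z; rewrite !inE mem_rcons inE negb_or.
      (* Read backwards, this shows that the counter to be lowered is positive, so the subtraction
         is not truncated. *)
      have := @layered_add y ((~: [set z in l]) :\ y) j; rewrite setD1K ?inE ?yl //.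
      rewrite eqxx => /(_ isT) cntE.
      by rewrite eq_sym; case: eqP cntE => [-> | _]; rewrite cnt2 // => -> /=;
        rewrite ?add1n ?subn1 ?add0n.
    move=> l s2 uniq_l mem_l un2 cnt2.
    have {}cnt2 : counts s2 [set w | ~~ D x w].
      move=> j /cnt2 ->; apply: eq_card => z; rewrite !inE mem_l inE //.
    do 2! [apply: runs_step => //]; set s3 := run _ _.
    have rs2 : ready s2.
      by apply: ready_unchanged un2 rs1.
    have un3 : unchanged (Const rAcc 0 ;; Read rTmp aSize rAcc) s2 s3 by apply: run_unchanged.
    have rs3 : ready s3 by apply: ready_unchanged un3 rs2.
    have cnt3 : counts s3 [set w | ~~ D x w] by [].
    apply: runs_seq; apply: runs_unchanged (@scan_correct s3 x _ cnt3 _ _ _) _ => //.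
      by case: rs3.
    move=> s4 un4 reach_x.
    have rs4 : ready s4 by apply: ready_unchanged un4 rs3.
    have lay4 : arr s4 aLayer x = layer x by rewrite un4.2 // un3.2 // un2.2 // lay1.
    have s4v : reg s4 rV = x by rewrite un4.1 // un3.1 // un2.1.
    have s4W : reg s4 rWidth = \max_(y : 'I_n | y < x) reach D y.
      by rewrite un4.1 // un3.1 // un2.1 //=.
    have cnt4 : counts s4 [set w | ~~ D x w] by move=> j /cnt3 <-; rewrite un4.2.
    do 3! [apply: runs_step => //]; set s5 := run _ _.
    have un5 : unchanged (Read rTmp aLayer rV ;; Defs.Sub rTmp rTmp rAcc ;;
        IfLt rWidth rTmp (Move rWidth rTmp) Skip) s4 s5 by apply: run_unchanged.
    have rs5 : ready s5 by apply: ready_unchanged un5 rs4.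
    have s5W : reg s5 rWidth = \max_(y : 'I_n | y < x.+1) reach D y.
      rewrite (bigD1 x) /= ?ltnS // -[X in maxn _ X](_ : reg s4 rWidth = _); last first.
        by rewrite s4W; apply: eq_bigl => y; rewrite ltnS ltn_neqAle andbC.
      rewrite reach_x -lay4 -s4v /s5 /= {un5 rs5 s5}.
      by case: ltnP => cmp; rewrite /= /update /= in cmp *; lia.
    have lay5 (y : 'I_n) : arr s5 aLayer y = layer y.
      by rewrite un5.2 // un4.2 // un3.2 // un2.2.
    (* The second traversal adds the out-neighbours back, until all vertices are counted again. *)
    apply: (@runs_neighbours _ (fun l s' => counts s' ([set w | ~~ D x w] :|: [set y in l]) /\
       reg s' rWidth = \max_(y : 'I_n | y < x.+1) reach D y) 4 x) => //.
    + by move=> l' s6 r k; rewrite !inE => /orP[] /eqP->.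
    + by rewrite un5.1.
    + split=> // j lt_jn; rewrite un5.2 // cnt4 //; apply: eq_card => y.
      by rewrite !inE orbF.
    + move=> l' y s6 yl Dxy un6 s6u [cnt6 s6W]; apply: runs_loop_free => //; split=> //.
      move=> j lt_jn; have lay6 : arr s6 aLayer y = layer y by rewrite un6.2.
      rewrite /= /update /= s6u lay6.
      have -> : [set w | ~~ D x w] :|: [set z in rcons l' y] =
          y |: ([set w | ~~ D x w] :|: [set z in l']).
        by apply/setP => z; rewrite !inE mem_rcons inE orbCA.
      rewrite layered_add ?inE ?Dxy // -cnt6 // eq_sym.
      by case: eqP => // ->.
    move=> l' s6 _ mem_l' _ [cnt6 s6W]; split=> // j lt_jn; rewrite cnt6 //.
    by apply: eq_card => y; rewrite !inE mem_l' inE orNb.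
  rewrite /=; lia.
by rewrite big_split /= sum_affine sum_nat_const card_ord; lia.
Qed.

Lemma layers_program_correct s :
  input_adjacency_lists D s ->
  exists t s', [/\ exec layers_program s t s', t <= 60 * (n + arcs).+1
    & outputs (layers D) (\max_x reach D x) s'].
Proof.
move=> input.
suff [t [s' [ex le_t out]]] : runs layers_program s (60 * (n + arcs).+1)
    (outputs (layers D) (\max_x reach D x)) by exists t, s'.
eapply runs_leq.
  apply: runs_seq; apply: runs_unchanged (initialize_correct input) _.
  move=> s1 _ [rs1 out1 deg1 cnt1 [hgt1 wid1]].
  apply: runs_seq; apply: runs_unchanged (sort_by_outdeg_correct rs1 deg1) _.
  move=> s2 un2 [L0 [uniq_L0 mem_L0 deg2]].
  have rs2 : ready s2 by apply: ready_unchanged un2 rs1.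
  have as2 : assigned s2 [::].
    split=> //; first by move=> j /out1; rewrite !un2.2.
      move=> j /cnt1; rewrite un2.2 // => ->; apply: eq_card => x; rewrite !inE //.
    by rewrite big_nil un2.1.
  apply: runs_seq; apply: runs_unchanged (find_layers_correct rs2 uniq_L0 mem_L0 deg2 as2) _.
  move=> s3 un3 [L [uniq_L mem_L [out3 lay3 cnt3 hgt3]]].
  have rs3 : ready s3 by apply: ready_unchanged un3 rs2.
  apply: runs_seq; apply: runs_unchanged (@find_width_correct s3 rs3 _ _ _) _.
  - by rewrite un3.1 // un2.1.
  - by move=> x; apply: lay3; rewrite mem_L.
  - by move=> j /cnt3 ->; apply: eq_card => x; rewrite !inE mem_L.
  move=> s4 un4 wid4; apply: (@runs_loop_free _ _ 1) => //; split=> //=.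
    rewrite /update /= un4.1 // hgt3 size_mkseq /height -[RHS]big_enum.
    by apply: perm_big; apply: uniq_perm; rewrite ?enum_uniq // => x; rewrite mem_L mem_enum.
  move=> i; have lt_iK : i < height D by rewrite -(size_layers D).
  (* [out3] speaks of indices below [n] only, hence the need to bound the number of layers. *)
  have lt_in : i < n.
    apply: leq_trans lt_iK _; apply/bigmax_leqP => x _; exact: layer_lt_n.
  exists [seq x <- L | layer x == i].
    split; first by rewrite filter_uniq.
    by move=> x; rewrite nth_layers // mem_filter (mem_L x) !inE andbT.
  by apply: vertex_list_linked; rewrite /= !un4.2 //; apply: out3.
(* Together the phases take at most [56 n + 29 arcs + 13] steps. *)
rewrite /=; lia.
Qed.
End Correctness.

Theorem theorem3p1 :
  (forall (T : finType) (G : rel T), incomparability_graph G ->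
     exists C : seq {set T},
       ordered_clique_cover G C /\ width_between_star_bounds G C) /\
  (exists (p : cmd) (c : nat),
     forall (n : nat) (G D : rel 'I_n) (s : state),
       simple_graph G -> transitive_orientation D (complement G) ->
       input_adjacency_lists D s ->
       exists (t : nat) (s' : state) (C : seq {set 'I_n}),
         [/\ exec p s t s', t <= c * (n + number_of_arcs D).+1,
             ordered_clique_cover G C, width_between_star_bounds G C
           & outputs C (width G C) s']).
Proof.
split=> [T G [simpleG [D orientD]]|].
  exists (layers D); split; first exact: (layers_cover orientD.1 simpleG orientD).
  exact: (width_layers_star orientD.1 simpleG orientD).
exists layers_program, 60 => n G D s simpleG orientD /(layers_program_correct orientD.1).
move=> [t [s' [ex le_t out]]]; exists t, s', (layers D); split=> //.
- exact: (layers_cover orientD.1 simpleG orientD).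
- exact: (width_layers_star orientD.1 simpleG orientD).
by rewrite (width_layers_reach orientD.1 simpleG orientD).
Qed.
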